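(* Let $n\ge d\ge 1$ be integers. If $p(x)$ is a monic polynomial of degree $d$ with (all roots) nonnegative real roots, then the roots $r_1(t)^2\ge\dots\ge r_d(t)^2\ge 0$ of $p(x,t)=\big(p\boxplus_d^n G_{n,d}^{[t]}\big)(x)$ satisfy $$\lim_{t\to\infty}\frac{r_k(t)^2}{t}=2\,\xi_k,\qquad k=1,\dots,d,$$ where $\xi_1>\dots>\xi_d>0$ are the roots of the Laguerre polynomial $L_d^{(n)}(x)$.
   Context: Rectangular convolution: for monic degree-$d$ polynomials $p(x)=x^d+\sum_{i=1}^d a_{2i}x^{d-i}$ and $q(x)=x^d+\sum_{i=1}^d b_{2i}x^{d-i}$, with $a_0=b_0=1$, the $(n,d)$-rectangular finite free convolution is $$(p\boxplus_d^n q)(x)=x^d+\sum_{k=1}^d x^{d-k}\sum_{\substack{i,j\ge 0\\ i+j=k}}\frac{(d-i)!(d-j)!}{d!(d-k)!}\,\frac{(n+d-i)!(n+d-j)!}{(n+d)!(n+d-k)!}\,a_{2i}b_{2j}.$$ It preserves nonnegative real-rootedness. Laguerre polynomials and Laguerre heat polynomials: with $m^{\downarrow k}=m(m-1)\cdots(m-k+1)$ for $k\ge 1$ and $m^{\downarrow 0}=1$, let $L_d^{(\alpha)}(x)=\sum_{k=0}^d\frac{(d+\alpha)^{\downarrow k}}{(d-k)!\,k!}(-x)^{d-k}$. For $t>0$ set $G_{n,d}^{[t]}(x)=(-2t)^d\, d!\, L_d^{(n)}\!\left(\frac{x}{2t}\right)$. Roots are listed with multiplicity. *)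

(* Defs.v *)
From HB Require Import structures.
From mathcomp Require Import all_boot all_order all_algebra.
From mathcomp Require Import all_classical all_reals all_analysis.

Set Implicit Arguments.
Unset Strict Implicit.
Unset Printing Implicit Defensive.

Import Order.TTheory GRing.Theory Num.Theory.
Import numFieldNormedType.Exports.

Local Open Scope ring_scope.

Definition falling (R : realType) (m : R) (k : nat) : R :=
  \prod_(i < k) (m - i%:R).

Definition laguerre (R : realType) (d : nat) (alpha : R) : {poly R} :=
  \sum_(k < d.+1)
    (falling (d%:R + alpha) k / ((d - k)`!%:R * k`!%:R)) *: (- 'X) ^+ (d - k).

(* G_{n,d}^{[t]}(x) = (-2t)^d d! L_d^{(n)}(x/(2t)); meant for t > 0 *)
Definition laguerre_heat (R : realType) (n d : nat) (t : R) : {poly R} :=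
  ((- 2 * t) ^+ d * d`!%:R) *:
    (laguerre d (n%:R : R) \Po ((2 * t)^-1 *: 'X)).

(* The coefficients a_{2i}, b_{2j} are p`_(d - i), q`_(d - j) (signs included),
   and j = k - i.  Meant for p and q monic of degree d. *)
Definition rect_conv (R : realType) (n d : nat) (p q : {poly R}) : {poly R} :=
  'X^d + \sum_(1 <= k < d.+1)
    (\sum_(i < k.+1)
       ((d - i)`!%:R * (d - (k - i))`!%:R / (d`!%:R * (d - k)`!%:R)) *
       ((n + d - i)`!%:R * (n + d - (k - i))`!%:R /
          ((n + d)`!%:R * (n + d - k)`!%:R)) *
       p`_(d - i) * q`_(d - (k - i))) *: 'X^(d - k).

(* s enumerates all the roots of p, with multiplicity; meant for size p = d.+1 *)
Definition roots_of (R : realType) (d : nat) (p : {poly R}) (s : 'I_d -> R) :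
    Prop :=
  p = lead_coef p *: \prod_(k < d) ('X - (s k)%:P).

Definition nonneg_real_rooted (R : realType) (d : nat) (p : {poly R}) : Prop :=
  exists s : 'I_d -> R, roots_of p s /\ forall k, 0 <= s k.

(* Main.v *)
Require Import Defs.
From HB Require Import structures.
From mathcomp Require Import all_boot all_order all_algebra.
From mathcomp Require Import all_classical all_reals all_analysis.
From mathcomp Require Import ring lra.
From mathcomp.real_closed Require polyrcf.

Set Implicit Arguments.
Unset Strict Implicit.
Unset Printing Implicit Defensive.

Import Order.TTheory GRing.Theory Num.Theory.
Import numFieldNormedType.Exports.

Local Open Scope classical_set_scope.
Local Open Scope ring_scope.

(** Convolving with the Laguerre heat polynomial is running a heat flow.  Let
[T = x D^2 + (n + 1) D], the radial Laplacian, so that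
[T x^m = m (n + m) x^(m - 1)].  Comparing coefficients shows that the
convolution of [p] with [G^[t]] is [exp (- 2 t T) p]
([laguerre_heat_heatXn] and [rect_conv_heat_flow]), and that [exp (- T) x^d]
is the monic multiple of the Laguerre polynomial ([laguerre_heatXn]).

Real-rootedness comes from conjugation.  The operator
[X = exp (- s T) x exp (s T)] has the closed form
[x (1 - s D)^2 - s (n + 1) (1 - s D)], because the iterated commutators of [T]
with [x] stop after the second one.  Hence [exp (- s T)] sends
[(x - a_1) ... (x - a_d)] to [(X - a_1) ... (X - a_d) 1], and it is enough to
see that [X - a], with [a >= 0] and [s > 0], maps polynomials with simple
positive roots to polynomials with simple positive roots ([heatXB_roots]).
This is an interlacing argument: the signs of [(X - a) g] alternate at the
zeros of [g - s g'] together with [0].  So for every [t > 0] the flow of a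
nonnegatively rooted [p] has simple positive roots, and so does the Laguerre
polynomial, as the flow of [x^d].

For the limit, [exp (- s T)] is homogeneous under [x -> s x]
([horner_heatXn_scale]), so that [(exp (- s T) p)(s y) / s^d] tends to
[(exp (- T) x^d)(y)] as [s] grows: the lower coefficients of [p] carry negative
powers of [s].  The limit changes sign across each of its simple roots; for
large [t] the polynomial at time [t] therefore has one root in each of [d]
small disjoint intervals around the [2 t xi_k], and those are all its roots
([scaled_roots_cvg]). *)

(** * Simple roots and alternating signs *)

Section Interlacing.
Variable R : rcfType.
Implicit Types (p q g h : {poly R}) (x y : nat -> R) (k i j : nat).

(** Roots are indexed by all of [nat], with only the first [k] values relevant:
the degree then varies along an induction with no casts between ordinals. *)
Definition prod_roots k x : {poly R} := \prod_(i < k) ('X - (x i)%:P).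

Definition decreasing_upto k x := forall i j, (i < j < k)%N -> x j < x i.

Lemma monic_prod_roots k x : prod_roots k x \is monic.
Proof. exact: monic_prod_XsubC. Qed.

Lemma size_prod_roots k x : size (prod_roots k x) = k.+1.
Proof.
rewrite /prod_roots -(big_mkord xpredT (fun i => 'X - (x i)%:P)).
by rewrite size_prod_XsubC size_iota subn0.
Qed.

Lemma root_prod_roots k x i : (i < k)%N -> (prod_roots k x).[x i] = 0.
Proof.
move=> ik; rewrite /prod_roots (bigD1 (Ordinal ik)) //= hornerM !hornerE.
by rewrite subrr mul0r.
Qed.

Lemma monic_roots_eq_prod k x p : p \is monic -> size p = k.+1 ->
  decreasing_upto k x -> (forall i, (i < k)%N -> root p (x i)) ->
  p = prod_roots k x.
Proof.
move=> /monicP p1 sp dx rx.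
have := @all_roots_prod_XsubC _ p (mkseq x k); rewrite size_mkseq => /(_ sp).
have -> : \prod_(z <- mkseq x k) ('X - z%:P) = prod_roots k x.
  rewrite /prod_roots -(big_mkord xpredT (fun i => 'X - (x i)%:P)).
  by rewrite big_map /index_iota subn0.
rewrite p1 scale1r; apply.
  by apply/allP => _ /mapP[i + ->]; rewrite mem_iota => /andP[_ /rx].
rewrite uniq_rootsE; apply/mkseq_uniqP => i j; rewrite !inE => ik jk xij.
case: (ltngtP i j) => // lij.
  by have := dx i j; rewrite lij jk xij ltxx => /(_ isT).
by have := dx j i; rewrite lij ik xij ltxx => /(_ isT).
Qed.

(** Distributing the sign over the factors turns sign statements about products
into factorwise ones. *)
Lemma prod_sign k i : (i <= k)%N ->
  \prod_(j < k) (if (j < i)%N then -1 else 1) = (-1) ^+ i :> R.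
Proof.
move=> ik; rewrite -big_mkcond /= -(big_ord_widen k (fun=> -1 : R) ik).
by rewrite prodr_const card_ord.
Qed.

(** With the roots in decreasing order, exactly [i] factors are negative
at a point that lies between the roots number [i - 1] and [i]; the sign does
not depend on the degree. *)
Lemma sign_prod_roots k x i (b : R) : (i <= k)%N ->
  (forall j, (j < i)%N -> b < x j) ->
  (forall j, (i <= j < k)%N -> x j < b) ->
  0 < (-1) ^+ i * (prod_roots k x).[b].
Proof.
move=> ik lo hi; rewrite -(prod_sign ik) horner_prod -big_split /=.
apply: prodr_gt0 => j _; rewrite !hornerE; case: ltnP => ji.
  by rewrite mulN1r opprB subr_gt0 lo.
by rewrite mul1r subr_gt0 hi // ji ltn_ord.
Qed.

(** At a simple root only one term of the product rule survives: the product of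
the differences with the other roots, [i] of which are negative. *)
Lemma sign_deriv_prod_roots k x i : decreasing_upto k x -> (i < k)%N ->
  0 < (-1) ^+ i * ((prod_roots k x)^`()).[x i].
Proof.
move=> dx ik; rewrite -(prod_sign (ltnW ik)) /prod_roots.
rewrite (bigD1 (Ordinal ik)) //= ltnn mul1r.
rewrite [X in X^`()](bigD1 (Ordinal ik)) //=.
rewrite derivM derivXsubC mul1r !hornerE subrr mul0r addr0.
rewrite horner_prod -big_split /=.
apply: prodr_gt0 => j ji; rewrite !hornerE; case: ltnP => lji.
  by rewrite mulN1r opprB subr_gt0 dx // lji ik.
rewrite mul1r subr_gt0 dx // ltn_ord andbT ltn_neqAle lji andbT.
by rewrite eq_sym.
Qed.

Lemma sign_change_root p a b : a < b -> p.[a] * p.[b] < 0 ->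
  exists z, [/\ a < z, z < b & root p z].
Proof.
move=> ab /(polyrcf.poly_ivtoo (ltW ab)) [z]; rewrite in_itv /= => /andP[? ?] ?.
by exists z.
Qed.

(** Each sign change encloses a root, and one more lies above [y 0], where [p]
is negative although it tends to [+oo].  These are [k] distinct roots, hence
all of them. *)
Lemma alternating_roots k y p : p \is monic -> size p = k.+1 ->
  decreasing_upto k y -> (forall i, (i < k)%N -> (-1) ^+ i * p.[y i] < 0) ->
  exists x, [/\ p = prod_roots k x, decreasing_upto k x,
    (forall i, (i < k)%N -> y i < x i) &
    (forall i j, (i < j < k)%N -> x j < y i)].
Proof.
move=> pm sp dy alt.
have ex i : exists z, (i < k)%N ->
    [/\ root p z, y i < z & (0 < i)%N -> z < y i.-1].
  case: (ltnP i k) => [ik|_]; last by exists 0.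
  case: i ik => [|i] ik.
    (* the topmost root, between [y 0] and a point where [p] is positive *)
    have lp : 0 < lead_coef p by rewrite (monicP pm).
    have [b Hb] := polyrcf.poly_pinfty_gt_lc lp.
    pose c := Num.max b (y 0%N + 1).
    have yc : y 0%N < c by rewrite lt_max ltrDl ltr01 orbT.
    have pc : 0 < p.[c] by rewrite (lt_le_trans lp) // Hb // le_max lexx.
    have := alt _ ik; rewrite expr0 mul1r => py.
    have [|z [? _ ?]] := @sign_change_root p _ _ yc; last by exists z.
    by rewrite nmulr_rlt0.
  have yy : y i.+1 < y i by apply: dy; rewrite ltnSn ik.
  have := alt _ ik; have := alt _ (ltnW ik).
  rewrite exprS mulN1r mulNr oppr_lt0 => h1 h2.
  have [|z [? ? ?]] := @sign_change_root p _ _ yy; last by exists z.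
  have : ((-1) ^+ i * p.[y i]) * ((-1) ^+ i * p.[y i.+1]) < 0.
    by rewrite nmulr_rlt0.
  by rewrite mulrACA -expr2 sqrr_sign mul1r mulrC.
have [x Hx] := choice ex.
have xy i j : (i < j < k)%N -> x j < y i.
  move=> /andP[ij jk]; have [_ _ /(_ (leq_trans _ ij))] := Hx _ jk.
  move=> /(_ isT) /lt_le_trans; apply.
  case: j ij jk => // j ij jk /=.
  rewrite leq_eqVlt in ij; case/orP: ij => [/eqP[->]|ij] //.
  by apply/ltW/dy; rewrite -ltnS ij ltnW.
have yx i : (i < k)%N -> y i < x i by move=> /Hx[].
have dx : decreasing_upto k x.
  move=> i j /[dup] ijk /andP[ij jk].
  by rewrite (lt_trans (xy _ _ ijk)) // yx // (ltn_trans ij).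
exists x; split => //; apply: monic_roots_eq_prod => // i ik.
by have [] := Hx _ ik.
Qed.

End Interlacing.

(** * The conjugated multiplication operator *)

Section Heat.
Variable R : rcfType.
Variables (s : R) (n : nat).
Implicit Types (p q g h : {poly R}) (x : nat -> R) (k i j : nat) (a : R).

(** Up to the factor [- s], the derivative conjugated by [exp (- x / s)]: its zeros
are the critical points of [exp (- x / s) g]. *)
Definition twist_deriv g : {poly R} := g - s *: g^`().

(** Multiplication by [x] conjugated by [exp (- s T)], where
[T = x D^2 + (n + 1) D]. *)
Definition heatX g : {poly R} :=
  'X * twist_deriv (twist_deriv g) - (s * n.+1%:R) *: twist_deriv g.

Lemma twist_derivD g h : twist_deriv (g + h) = twist_deriv g + twist_deriv h.
Proof. by rewrite /twist_deriv derivD scalerDr opprD addrACA. Qed.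

Lemma twist_derivZ a g : twist_deriv (a *: g) = a *: twist_deriv g.
Proof. by rewrite /twist_deriv derivZ scalerBr !scalerA mulrC. Qed.

Lemma heatXD g h : heatX (g + h) = heatX g + heatX h.
Proof. by rewrite /heatX !twist_derivD mulrDr scalerDr opprD addrACA. Qed.

Lemma heatXZ a g : heatX (a *: g) = a *: heatX g.
Proof.
by rewrite /heatX !twist_derivZ -scalerAr [RHS]scalerBr !scalerA (mulrC a).
Qed.

Lemma heatX_sum k (c : nat -> R) (F : nat -> {poly R}) :
  heatX (\sum_(i < k) c i *: F i) = \sum_(i < k) c i *: heatX (F i).
Proof.
elim: k => [|k IH]; last by rewrite !big_ord_recr /= heatXD heatXZ IH.
by rewrite !big_ord0 -(scale0r 0) heatXZ !scale0r.
Qed.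

Lemma size_twist_deriv g : size (twist_deriv g) = size g.
Proof.
have [->|g0] := eqVneq g 0; first by rewrite /twist_deriv deriv0 scaler0 subr0.
rewrite /twist_deriv size_polyDl // size_polyN.
by apply: leq_ltn_trans (size_scale_leq _ _) (lt_size_deriv g0).
Qed.

Lemma lead_coef_twist_deriv g : lead_coef (twist_deriv g) = lead_coef g.
Proof.
have [->|g0] := eqVneq g 0; first by rewrite /twist_deriv deriv0 scaler0 subr0.
rewrite /twist_deriv lead_coefDl // size_polyN.
by apply: leq_ltn_trans (size_scale_leq _ _) (lt_size_deriv g0).
Qed.

Lemma size_heatX_tail a g : g != 0 ->
  (size (- ((s * n.+1%:R) *: twist_deriv g) - a *: g)%R
    < size ('X * twist_deriv (twist_deriv g))%R)%N.
Proof.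
move=> g0; rewrite (mulrC 'X) size_mulX ?size_twist_deriv; last first.
  by rewrite -size_poly_eq0 !size_twist_deriv size_poly_eq0.
rewrite ltnS (leq_trans (size_polyD _ _)) // geq_max !size_polyN.
by rewrite (leq_trans (size_scale_leq _ _)) ?size_twist_deriv // size_scale_leq.
Qed.

Lemma size_heatXB a g : g != 0 -> size (heatX g - a *: g) = (size g).+1.
Proof.
move=> g0; rewrite /heatX -addrA size_polyDl; last exact: size_heatX_tail.
rewrite (mulrC 'X) size_mulX; first by rewrite !size_twist_deriv.
by rewrite -size_poly_eq0 !size_twist_deriv size_poly_eq0.
Qed.

Lemma lead_coef_heatXB a g : g != 0 ->
  lead_coef (heatX g - a *: g) = lead_coef g.
Proof.
move=> g0; rewrite /heatX -addrA lead_coefDl; last exact: size_heatX_tail.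
by rewrite (mulrC 'X) lead_coefMX !lead_coef_twist_deriv.
Qed.

(** Let [m = g - s g'].  At a root [x_i] of [g], the value of [m] is
[- s g'(x_i)], so the signs alternate and [m] has simple roots
[c_0 > x_0 > c_1 > x_1 > ...].  At [c_i] the image of [g] is
[- s c_i m'(c_i) - a g(c_i)], where [m'] and [g] have the same sign, and at [0]
it is [- s (n + 1) m(0) - a g(0)], where [m] and [g] again have the same sign.
So the image alternates on [c_0 > ... > c_{k-1} > 0]. *)
Lemma heatXB_roots k x a : 0 < s -> 0 <= a -> decreasing_upto k x ->
  (forall i, (i < k)%N -> 0 < x i) ->
  exists z, [/\
    heatX (prod_roots k x) - a *: prod_roots k x = prod_roots k.+1 z,
    decreasing_upto k.+1 z & forall i, (i < k.+1)%N -> 0 < z i].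
Proof.
move=> s0 a0 dx x0; set g := prod_roots k x.
have gm : g \is monic := monic_prod_roots k x.
have g0 : g != 0 by apply: monic_neq0.
(* [m] is kept opaque so that evaluation does not expand it *)
have [m mdef] : exists m, twist_deriv g = m by exists (twist_deriv g).
have [c [mE dc xc cx]] : exists c, [/\ m = prod_roots k c, decreasing_upto k c,
    (forall i, (i < k)%N -> x i < c i) &
    (forall i j, (i < j < k)%N -> c j < x i)].
  apply: alternating_roots => //.
  - by rewrite -mdef monicE lead_coef_twist_deriv -monicE.
  - by rewrite -mdef size_twist_deriv size_prod_roots.
  - move=> i ik; rewrite -mdef /twist_deriv !hornerE root_prod_roots // sub0r.
    by rewrite mulrN mulrCA oppr_lt0 mulr_gt0 // sign_deriv_prod_roots.
have c0 i : (i < k)%N -> 0 < c i by move=> ik; rewrite (lt_trans (x0 _ ik)) ?xc.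
pose y i := if (i < k)%N then c i else 0.
have y0 i : 0 <= y i by rewrite /y; case: ifP => // /c0/ltW.
have [z [hE dz yz _]] : exists z, [/\ heatX g - a *: g = prod_roots k.+1 z,
    decreasing_upto k.+1 z, (forall i, (i < k.+1)%N -> y i < z i) &
    (forall i j, (i < j < k.+1)%N -> z j < y i)].
  apply: alternating_roots => //.
  - by rewrite monicE lead_coef_heatXB // -monicE.
  - by rewrite size_heatXB // size_prod_roots.
  - move=> i j /andP[ij jk]; have ik : (i < k)%N by exact: (leq_trans ij jk).
    rewrite /y ik; case: ifP => [jk'|_]; last exact: c0.
    by apply: dc; rewrite ij.
  - move=> i; rewrite ltnS leq_eqVlt => /orP[/eqP->|ik].
      rewrite /y ltnn.
      have sg : 0 < (-1) ^+ k * g.[0].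
        apply: sign_prod_roots => // j /andP[h1 h2].
        by move: h1; rewrite leqNgt h2.
      have sm : 0 < (-1) ^+ k * m.[0].
        rewrite mE; apply: sign_prod_roots => // j /andP[h1 h2].
        by move: h1; rewrite leqNgt h2.
      have -> : (heatX g - a *: g).[0] = - (s * n.+1%:R * m.[0] + a * g.[0]).
        by rewrite /heatX mdef !hornerE ?mul0r ?sub0r opprD.
      rewrite mulrN oppr_lt0 mulrDr (mulrCA _ _ m.[0]) (mulrCA _ _ g.[0]).
      rewrite (ltr_pwDl _ (mulr_ge0 a0 (ltW sg))) // (mulr_gt0 _ sm) //.
      by rewrite mulr_gt0 ?ltr0Sn.
    rewrite /y ik.
    have sg : 0 < (-1) ^+ i * g.[c i].
      apply: sign_prod_roots => [|j ji|j /andP[ij jk]]; first exact: ltnW.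
        by apply: cx; rewrite ji.
      move: ij; rewrite leq_eqVlt => /orP[/eqP->|ij]; first exact: xc.
      by rewrite (lt_trans _ (xc _ ik)) // dx // ij.
    have sm : 0 < (-1) ^+ i * (m^`()).[c i].
      by rewrite mE; apply: sign_deriv_prod_roots.
    have mc : m.[c i] = 0 by rewrite mE root_prod_roots.
    have -> : (heatX g - a *: g).[c i] =
        - (c i * s * (m^`()).[c i] + a * g.[c i]).
      rewrite /heatX mdef /(twist_deriv m) !hornerE mc mulr0 subr0 sub0r.
      by rewrite mulrN opprD mulrA.
    rewrite mulrN oppr_lt0 mulrDr (mulrCA _ _ (_.[_])) (mulrCA _ a).
    rewrite (ltr_pwDl _ (mulr_ge0 a0 (ltW sg))) // (mulr_gt0 _ sm) //.
    by rewrite mulr_gt0 ?c0.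
by exists z; split => // i ik; rewrite (le_lt_trans _ (yz _ ik)).
Qed.

(** The image of ['X^m] under [exp (- s T)], as [T] kills the constant [1]. *)
Definition heatXn m : {poly R} := iter m heatX 1.

(** The operator [exp (- s T)] on polynomials. *)
Definition heat_flow p : {poly R} := \sum_(i < size p) p`_i *: heatXn i.

(** A range of summation that is independent of [p] is what makes the linearity
of the flow usable. *)
Lemma heat_flowE k p : (size p <= k)%N ->
  heat_flow p = \sum_(i < k) p`_i *: heatXn i.
Proof.
move=> pk; rewrite /heat_flow (big_ord_widen k (fun i => p`_i *: heatXn i) pk).
rewrite big_mkcond.
apply: eq_bigr => i _; case: ltnP => // ip.
by rewrite nth_default ?scale0r.
Qed.

Lemma heat_flowMXsubC a q :
  heat_flow (('X - a%:P) * q) = heatX (heat_flow q) - a *: heat_flow q.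
Proof.
have [k qk] := ex_intro (fun k => size q <= k)%N _ (leqnn (size q)).
have qk1 : (size (('X - a%:P) * q)%R <= k.+1)%N.
  by rewrite (leq_trans (size_polyMleq _ _)) // size_XsubC.
rewrite (heat_flowE qk1) [X in heatX X](heat_flowE qk).
rewrite [X in a *: X](heat_flowE (leqW qk)).
rewrite heatX_sum scaler_sumr.
under eq_bigr do rewrite mulrBl coefB coefCM coefXM scalerBl -scalerA.
rewrite sumrB big_ord_recl /= scale0r add0r; congr (_ - _).
Qed.

Lemma heat_flow_prod_roots (r : seq R) : 0 < s -> all (fun a => 0 <= a) r ->
  exists z, [/\ heat_flow (\prod_(a <- r) ('X - a%:P)) = prod_roots (size r) z,
    decreasing_upto (size r) z & forall i, (i < size r)%N -> 0 < z i].
Proof.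
move=> s0; elim: r => [|a r IH] /= => [_|/andP[a0 /IH[z [hE dz z0]]]].
  exists (fun=> 0); split => [|i j /andP[_]|i] //.
  rewrite big_nil /heat_flow size_poly1 big_ord_recl big_ord0 /= coefC eqxx.
  by rewrite scale1r addr0 /prod_roots big_ord0.
by rewrite big_cons heat_flowMXsubC hE; apply: heatXB_roots.
Qed.

Lemma coef_heatX g l : (heatX g)`_l =
  (if l is l'.+1 then g`_l' else 0) - s * (l%:R + l%:R + n%:R + 1) * g`_l +
  s ^+ 2 * ((l%:R + 1) * (l%:R + n%:R + 1)) * g`_l.+1.
Proof.
rewrite /heatX /twist_deriv mulrBr coefB coefZ !coefB !coefXM.
rewrite -(natr1 n) !(coefB, coefZ, coef_deriv).
case: l => [|l] /=; rewrite ?(coefB, coefZ, coef_deriv).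
  move: g`_0 g`_1 => u v.
  ring.
rewrite -!(mulr_natr (_ - _)) -!(mulr_natr (_`_ _)).
move: g`_l g`_l.+1 g`_l.+2 => u v w.
rewrite -(natr1 l.+1) -(natr1 l).
ring.
Qed.


(** The product of the factors [j (n + j)] that [T] picks up from [x^m] down to
a constant, times [n!]. *)
Definition weight m : R := (m`! * (n + m)`!)%:R.

Lemma weightS m : weight m.+1 = (m%:R + 1) * (n%:R + m%:R + 1) * weight m.
Proof.
rewrite /weight addnS !factS !natrM -(natr1 m) -(natr1 (n + m)) natrD.
by rewrite mulrACA.
Qed.

Lemma weight_neq0 m : weight m != 0.
Proof. by rewrite pnatr_eq0 -lt0n muln_gt0 !fact_gt0. Qed.

(** The coefficient of [x^l] in the series of [exp (- s T) x^m], whose only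
contribution is the term [(- s T)^(m - l) / (m - l)!]. *)
Lemma coef_heatXn m l : (heatXn m)`_l = if (l <= m)%N then
  (- s) ^+ (m - l) * (weight m / (weight l * (m - l)`!%:R)) else 0.
Proof.
have fN0 i : i`!%:R != 0 :> R by rewrite pnatr_eq0 -lt0n fact_gt0.
have sN0 i : (i%:R + 1) != 0 :> R by rewrite natr1 pnatr_eq0.
have tN0 i : (n%:R + i%:R + 1) != 0 :> R by rewrite -natrD.
have fS i : (i.+1)`!%:R = (i%:R + 1) * i`!%:R :> R by rewrite factS natrM natr1.
elim: m l => [|m IH] l.
  rewrite /heatXn /= coefC; case: l => [|l] //=.
  by rewrite subn0 expr0 fact0 mulr1 mul1r divff ?weight_neq0.
rewrite /heatXn /= -/(heatXn m) coef_heatX.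
have -> : (if l is l'.+1 then (heatXn m)`_l' else 0) =
    (if l is l'.+1 then (if (l' <= m)%N then
      (- s) ^+ (m - l') * (weight m / (weight l' * (m - l')`!%:R))
      else 0) else 0).
  by case: l.
rewrite !IH; have [lm|ml] := leqP l m; last first.
  case: l ml => // l; rewrite ltnS leq_eqVlt => /orP[/eqP <-|ml].
    rewrite !leqnn (ltnNge m.+1) leqnSn /= !mulr0 subr0 addr0.
    by rewrite !subnn !expr0 fact0 !mulr1 !mul1r !divff ?weight_neq0.
  have lm1 : (l.+1 < m)%N = false by rewrite ltnNge ltnW // (ltn_trans ml).
  by rewrite ltnS leqNgt ml lm1 /= !mulr0 subr0 addr0.
rewrite (leqW lm).
move: lm => /subnKC <-; move: (m - l)%N => j {m IH}.
rewrite addKn -(addnS l j) addKn.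
have -> : (if (l < l + j)%N then (- s) ^+ (l + j - l.+1) *
    (weight (l + j) / (weight l.+1 * (l + j - l.+1)`!%:R)) else 0) =
   (if j is j'.+1 then (- s) ^+ j' *
    (weight (l + j) / (weight l.+1 * j'`!%:R)) else 0).
  case: j => [|j]; first by rewrite addn0 ltnn.
  by rewrite -addSnnS leq_addr addKn.
have -> : (if l is l'.+1 then (if (l' <= l + j)%N then
     (- s) ^+ (l + j - l') * (weight (l + j) / (weight l' * (l + j - l')`!%:R))
     else 0) else 0) =
   (if l is l'.+1 then
     (- s) ^+ j.+1 * (weight (l + j) / (weight l' * (j.+1)`!%:R)) else 0).
  case: l => [|l] //; by rewrite addSnnS leq_addr addKn.
rewrite [in RHS]addnS [in RHS]weightS natrD.
move: (weight (l + j)) => W.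
case: l => [|l]; case: j => [|j]; rewrite ?fS ?weightS ?expr0 ?exprS ?fact0.
- have := weight_neq0 0; move: (weight 0) => w w0; field.
  by [].
- have := tN0 0; have := sN0 j.+1; have := sN0 j; have := fN0 j.
  have := weight_neq0 0; rewrite -(natr1 j) addr0.
  move: (weight 0) (_ ^+ j) j`!%:R j%:R => w sj fj J w0 h1 h2 h3 h4.
  field.
  by rewrite w0 h1 h2 h3 h4.
- have := tN0 l; have := sN0 l; have := weight_neq0 l; rewrite -(natr1 l).
  move: (weight l) l%:R => w L w0 h1 h2; field.
  by rewrite w0 h1 h2.
have := tN0 l; have := sN0 l; have := tN0 l.+1; have := sN0 l.+1.
have := sN0 j.+1; have := sN0 j; have := fN0 j; have := weight_neq0 l.
rewrite -(natr1 l) -(natr1 j).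
move: (weight l) (_ ^+ j) j`!%:R j%:R l%:R => w sj fj J L.
move=> w0 h1 h2 h3 h4 h5 h6 h7.
field.
  by rewrite w0 h1 h2 h3 h4 h5 h6 h7.
Qed.

End Heat.

(** * Laguerre polynomials and the rectangular convolution *)

Section Link.
Variable R : realType.
Implicit Types (p q : {poly R}) (s t : R) (n d k l i : nat).

Lemma fact_neq0 k : k`!%:R != 0 :> R.
Proof. by rewrite pnatr_eq0 -lt0n fact_gt0. Qed.

Lemma falling_nat m k : (k <= m)%N ->
  falling (m%:R : R) k = m`!%:R / (m - k)`!%:R.
Proof.
elim: k => [|k IH] km.
  by rewrite /falling big_ord0 subn0 divff ?fact_neq0.
rewrite /falling big_ord_recr /= -/(falling _ _) IH 1?ltnW // -natrB 1?ltnW //.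
have -> : (m - k = (m - k.+1).+1)%N by rewrite -subSn.
rewrite factS natrM -mulrA; congr (_ * _).
by rewrite invfM mulrAC mulVf ?mul1r // pnatr_eq0.
Qed.

Lemma sum_scaleXn_rev d (c : nat -> R) :
  \sum_(k < d.+1) c k *: 'X^(d - k) = \poly_(l < d.+1) c (d - l)%N.
Proof.
rewrite poly_def (reindex_inj rev_ord_inj) /=; apply: eq_bigr => k _.
by rewrite subSS subKn // -ltnS.
Qed.

Lemma coef_comp_scaleX p (c : R) l : (p \Po (c *: 'X))`_l = p`_l * c ^+ l.
Proof.
rewrite comp_polyE.
under eq_bigr do rewrite exprZn scalerA.
rewrite -(poly_def _ (fun i => p`_i * c ^+ i)) coef_poly.
by case: ltnP => // h; rewrite nth_default // mul0r.
Qed.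

Lemma coef_heatXn_gt s n m l : (m < l)%N -> (heatXn s n m)`_l = 0.
Proof. by move=> ml; rewrite coef_heatXn leqNgt ml. Qed.

(** [T] lowers the degree by one, so each lost power of [x] brings one factor
[s]. *)
Lemma coef_heatXn_scale s n m l : (l <= m)%N ->
  (heatXn s n m)`_l = s ^+ (m - l) * (heatXn 1 n m)`_l.
Proof. by move=> lm; rewrite !coef_heatXn lm [RHS]mulrA -exprMn mulrN1. Qed.

Lemma laguerre_heatXn n d :
  laguerre d (n%:R : R) = ((-1) ^+ d / d`!%:R) *: heatXn 1 n d.
Proof.
rewrite /laguerre.
under eq_bigr do rewrite -(scaleN1r (_ : {poly R})) exprZn scalerA.
rewrite (sum_scaleXn_rev d (fun k => falling (d%:R + n%:R) k /
  ((d - k)`!%:R * k`!%:R) * (-1) ^+ (d - k))).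
apply/polyP => l; rewrite coefZ coef_poly ltnS coef_heatXn.
case: leqP => [ld|_]; last by rewrite mulr0.
rewrite -natrD falling_nat; last first.
  by rewrite (leq_trans (leq_subr _ _)) ?leq_addr.
have -> : (d + n - (d - l) = n + l)%N.
  by rewrite addnC -addnBA ?leq_subr // subKn.
rewrite subKn // /weight !natrM [(d + n)%N]addnC.
have -> : (-1) ^+ d = (-1) ^+ l * (-1) ^+ (d - l) :> R by rewrite -exprD subnKC.
have e : (-1) ^+ (d - l) * (-1) ^+ (d - l) = 1 :> R by rewrite -expr2 sqrr_sign.
have h1 := fact_neq0 d; have h2 := fact_neq0 l; have h3 := fact_neq0 (n + l).
have h4 := fact_neq0 (d - l).
transitivity ((-1) ^+ l * ((-1) ^+ (d - l) * (-1) ^+ (d - l)) *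
  ((n + d)`!%:R / (n + l)`!%:R / (l`!%:R * (d - l)`!%:R)) : R).
  by rewrite e; field; rewrite h2 h3 h4.
by field; rewrite h1 h2 h3 h4.
Qed.

Lemma laguerre_heat_heatXn n d t : t != 0 ->
  laguerre_heat n d t = heatXn (2 * t) n d.
Proof.
move=> t0; have s0 : 2 * t != 0 by rewrite mulf_neq0 // pnatr_eq0.
rewrite /laguerre_heat mulNr; move: (2 * t) s0 => s s0.
apply/polyP => l; rewrite coefZ coef_comp_scaleX laguerre_heatXn coefZ.
have [ld|dl] := leqP l d; last by rewrite !coef_heatXn_gt // mulr0 mul0r mulr0.
rewrite [RHS]coef_heatXn_scale //; move: (_`_l) => c.
have -> : (- s) ^+ d = (-1) ^+ d * (s ^+ (d - l) * s ^+ l).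
  by rewrite -exprD subnK // -exprMn mulN1r.
have e : (-1) ^+ d * (-1) ^+ d = 1 :> R by rewrite -expr2 sqrr_sign.
have h1 := fact_neq0 d; have h2 : s ^+ l != 0 by rewrite expf_neq0.
rewrite exprVn.
transitivity (((-1) ^+ d * (-1) ^+ d) * (s ^+ (d - l) * c)).
  by field; rewrite h1 h2.
by rewrite e mul1r.
Qed.

(** With [j = k - i], the factors [(d - j)! (n + d - j)!] of the convolution
cancel the denominators in the coefficients of [exp (- s T) x^d], and
[d! (n + d)!] cancels their numerators.  What is left next to the coefficient of
[x^(d - i)] in [p] is the coefficient of [x^(d - k)] in
[exp (- s T) x^(d - i)]. *)
Lemma rect_conv_heat_flow s n d p : p \is monic -> size p = d.+1 ->
  rect_conv n d p (heatXn s n d) = heat_flow s n p.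
Proof.
move=> pm sp; pose C k : R := \sum_(i < k.+1)
  ((d - i)`!%:R * (d - (k - i))`!%:R / (d`!%:R * (d - k)`!%:R)) *
  ((n + d - i)`!%:R * (n + d - (k - i))`!%:R /
    ((n + d)`!%:R * (n + d - k)`!%:R)) *
  p`_(d - i) * (heatXn s n d)`_(d - (k - i)).
have pd : p`_d = 1 by move/monicP: pm; rewrite lead_coefE sp.
(* the leading term ['X^d] of the convolution is the case [k = 0] of the general
   formula *)
have C0 : C 0%N = 1.
  rewrite /C big_ord_recl big_ord0 !subn0 addr0 pd coef_heatXn leqnn subnn.
  rewrite expr0 fact0 (mulr1 (weight _ _ _)).
  by rewrite !divff ?mulf_neq0 ?fact_neq0 ?weight_neq0 // !mul1r.
have -> : rect_conv n d p (heatXn s n d) = \sum_(k < d.+1) C k *: 'X^(d - k).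
  rewrite -(big_mkord xpredT (fun k => C k *: 'X^(d - k))) big_ltn //.
  by rewrite C0 scale1r subn0.
rewrite sum_scaleXn_rev; apply/polyP => l; rewrite coef_poly ltnS.
rewrite (heat_flowE _ _ (k := d.+1)) ?sp // coef_sum.
under [RHS]eq_bigr do rewrite coefZ.
case: leqP => [ld|dl]; last first.
  rewrite big1 // => i _; rewrite coef_heatXn_gt ?mulr0 //.
  by rewrite (leq_ltn_trans _ dl) // -ltnS.
rewrite (reindex_inj rev_ord_inj) /=.
under [RHS]eq_bigr do rewrite subSS.
rewrite /C (big_ord_widen d.+1 (fun i => (d - i)`!%:R * (d - (d - l - i))`!%:R /
  (d`!%:R * (d - (d - l))`!%:R) *
  ((n + d - i)`!%:R * (n + d - (d - l - i))`!%:R /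
    ((n + d)`!%:R * (n + d - (d - l))`!%:R)) * p`_(d - i) *
    (heatXn s n d)`_(d - (d - l - i)))); last by rewrite ltnS leq_subr.
rewrite big_mkcond /=; apply: eq_bigr => -[i /= id] _; rewrite ltnS.
case: leqP => [il|li]; last first.
  have dil : (d - i < l)%N by rewrite ltn_subCl // -ltnS.
  by have -> := coef_heatXn_gt s n dil; rewrite mulr0.
(* from here all the indices are sums of [i], [j] and [l], with no truncated
   subtraction left *)
have [j dE] : exists j, d = (i + j + l)%N.
  by exists (d - l - i)%N; rewrite subnKC // subnK.
rewrite !coef_heatXn leq_subr.
have -> : (d - l - i = j)%N by rewrite dE addnK addKn.
have -> : (d - i = j + l)%N by rewrite dE -addnA addKn.
have -> : (d - l = i + j)%N by rewrite dE addnK.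
have -> : (d - (i + j) = l)%N by rewrite dE addKn.
have -> : (d - j = i + l)%N by rewrite dE [(i + j)%N]addnC -addnA addKn.
have -> : (d - (i + l) = j)%N by rewrite dE addnAC addKn.
have -> : (n + d - i = n + (j + l))%N by rewrite dE -addnA addnCA addKn.
have -> : (n + d - j = n + (i + l))%N.
  by rewrite dE [(i + j)%N]addnC -addnA addnCA addKn.
have -> : (n + d - (i + j) = n + l)%N by rewrite dE addnCA addKn.
rewrite leq_addl addnK /weight !natrM.
have h1 := fact_neq0 d; have h2 := fact_neq0 (n + d); have h3 := fact_neq0 l.
have h4 := fact_neq0 (n + l); have h5 := fact_neq0 j.
have h6 := fact_neq0 (i + l); have h7 := fact_neq0 (n + (i + l)).
by field; rewrite h1 h2 h3 h4 h5 h6 h7.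
Qed.

Lemma horner_heatXn_scale s n m y :
  (heatXn s n m).[s * y] = s ^+ m * (heatXn 1 n m).[y].
Proof.
have sz (u : R) : (size (heatXn u n m) <= m.+1)%N.
  by apply/leq_sizeP => j mj; exact: coef_heatXn_gt.
rewrite !(horner_coef_wide _ (sz _)) mulr_sumr; apply: eq_bigr => -[i /= im] _.
rewrite ltnS in im; rewrite [in LHS]coef_heatXn_scale // exprMn.
have -> : s ^+ m = s ^+ (m - i) * s ^+ i by rewrite -exprD subnK.
ring.
Qed.

(** By homogeneity the left-hand side is a polynomial in [1 / (2 t)], whose
constant term comes from the leading term of [p]. *)
Lemma heat_flow_horner_cvg n d p y : p \is monic -> size p = d.+1 ->
  (heat_flow (2 * t) n p).[2 * t * y] / (2 * t) ^+ d @[t --> +oo] -->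
  (heatXn 1 n d).[y].
Proof.
move=> pm sp.
have pd : p`_d = 1 by move/monicP: pm; rewrite lead_coefE sp.
pose Q := \sum_(m < d.+1) (p`_m * (heatXn 1 n m).[y]) *: 'X^(d - m).
have Q0 : Q.[0] = (heatXn 1 n d).[y].
  rewrite /Q horner_sum big_ord_recr /= subnn !hornerE pd mul1r big1 ?add0r //.
  by move=> i _; rewrite !hornerE expr0n subn_eq0 leqNgt ltn_ord mulr0.
have cQ : Q.[(2 * t)^-1] @[t --> +oo] --> Q.[0].
  apply: (@cvg_comp _ _ _ (fun t => (2 * t)^-1) (horner Q)); last first.
    exact: continuous_horner.
  apply/gtr0_cvgV0.
    by near=> t; rewrite mulr_gt0.
  by apply: gt0_cvgMry => //; exact: cvg_id.
rewrite -Q0; apply: cvg_trans cQ; apply: near_eq_cvg; near=> t.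
have t0 : 0 < t by [].
have s0 : 2 * t != 0 by rewrite mulf_neq0 ?gt_eqF.
rewrite /Q horner_sum (heat_flowE _ _ (k := d.+1)) ?sp // horner_sum mulr_suml.
apply: eq_bigr => -[i /= id] _; rewrite ltnS in id.
rewrite !hornerE horner_heatXn_scale exprVn -{2}(subnK id) exprD.
have h1 : (2 * t) ^+ i != 0 by rewrite expf_neq0.
have h2 : (2 * t) ^+ (d - i) != 0 by rewrite expf_neq0.
by field; rewrite h1 h2.
Unshelve. all: by end_near.
Qed.

End Link.

(** * Roots of the flow and their growth *)

Section Main.
Variable R : realType.
Implicit Types (p q : {poly R}) (s t : R) (n d k l i : nat).

Lemma decreasing_roots_unique d (x : nat -> R) (y : 'I_d -> R) :
  decreasing_upto d x -> (forall i j : 'I_d, (i <= j)%N -> y j <= y i) ->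
  prod_roots d x = \prod_(k < d) ('X - (y k)%:P) -> forall i : 'I_d, y i = x i.
Proof.
move=> dx dy.
have sz (f : 'I_d -> R) : size [seq f i | i : 'I_d] = d.
  by rewrite size_map size_enum_ord.
have nthE (f : 'I_d -> R) (i : 'I_d) : nth 0 [seq f i | i : 'I_d] i = f i.
  by rewrite (nth_map i) ?size_enum_ord // nth_ord_enum.
have so (f : 'I_d -> R) : (forall i j : 'I_d, (i <= j)%N -> f j <= f i) ->
    sorted (fun u v => v <= u) [seq f i | i : 'I_d].
  move=> df; apply/(sortedP 0) => i; rewrite sz => id.
  have := nthE f (Ordinal id); have := nthE f (Ordinal (ltnW id)).
  by move=> /= -> ->; apply: df => /=.
rewrite /prod_roots -(big_image _ _ _ _ (fun z => 'X - z%:P)).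
rewrite -[RHS](big_image _ _ _ _ (fun z => 'X - z%:P)) => /prod_XsubC_eq pe i.
have -> : x i = nth 0 [seq x i | i : 'I_d] i by rewrite nthE.
rewrite -(nthE y); congr nth; apply/esym.
apply: (@sorted_eq _ (fun u v : R => v <= u)) pe.
- by move=> u v w /= h1 h2; apply: le_trans h1.
- by move=> u v /= /andP[h1 h2]; apply/le_anti; rewrite h1 h2.
- apply: so => j k; rewrite leq_eqVlt => /orP[/eqP/val_inj->//|jk].
  by apply/ltW/dx; rewrite jk /=.
- exact: so.
Qed.

Lemma eventually_same_sign (f : R -> R) (l : R) : l != 0 ->
  f t @[t --> +oo] --> l -> \forall t \near +oo, 0 < l * f t.
Proof.
move=> l0 fl; have : l * f t @[t --> +oo] --> l * l by apply: cvgMr.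
by move/cvgr_gt; apply; rewrite -expr2 exprn_even_gt0.
Qed.

Lemma heat_flow_roots n d p s : p \is monic -> size p = d.+1 ->
  nonneg_real_rooted d p -> 0 < s ->
  exists z, [/\ heat_flow s n p = prod_roots d z, decreasing_upto d z &
    forall i, (i < d)%N -> 0 < z i].
Proof.
move=> pm sp [a [ra a0]] s0.
have := @heat_flow_prod_roots R s n [seq a k | k : 'I_d] s0.
rewrite size_map size_enum_ord; case.
  by apply/allP => _ /mapP[k _ ->].
move=> z [hE dz z0]; exists z; split => //; rewrite -hE; congr heat_flow.
by rewrite ra (monicP pm) scale1r big_image.
Qed.

(** Sign changes are stable under pointwise convergence: the limit changes sign
on [[x i - dl, x i + dl]], hence so does the rescaled flow for large [t].  The
intervals are disjoint, so the roots found in them are in decreasing order,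
exhaust the degree, and must coincide in order with the given enumeration. *)
Lemma scaled_roots_cvg n d p (x : nat -> R) (z : R -> 'I_d -> R) :
  p \is monic -> size p = d.+1 ->
  decreasing_upto d x -> heatXn 1 n d = prod_roots d x ->
  (forall t, 0 < t -> heat_flow (2 * t) n p = \prod_(k < d) ('X - (z t k)%:P) /\
    forall i j : 'I_d, (i <= j)%N -> z t j <= z t i) ->
  forall k : 'I_d, z t k / t @[t --> +oo] --> 2 * x k.
Proof.
move=> pm sp dx xE zE k; apply/cvgrPdist_lt => e e0.
have [dl [dl0 dle gap]] : exists dl, [/\ 0 < dl, 2 * dl < e &
    forall i j : 'I_d, (i < j)%N -> x j + dl < x i - dl].
  have H : \forall u \near (0 : R)^'+, [/\ 0 < u, 2 * u < e &
      forall i j : 'I_d, (i < j)%N -> x j + u < x i - u].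
    have ne : \forall u \near (0 : R)^'+, u < e / 2.
      by apply: nbhs_right_lt; rewrite divr_gt0.
    have ng : \forall u \near (0 : R)^'+, forall i j : 'I_d, (i < j)%N ->
        u < (x i - x j) / 2.
      apply: filter_forall => i; apply: filter_forall => j.
      have [ij|ji] := ltnP i j; last by apply: nearW.
      have : 0 < (x i - x j) / 2.
        by rewrite divr_gt0 // subr_gt0 dx // ij /=.
      by move=> /nbhs_right_lt; apply: filterS.
    have n0 : \forall u \near (0 : R)^'+, 0 < u by apply: nbhs_right_gt.
    near=> u; split; first by near: u.
      have : u < e / 2 by near: u.
      lra.
    move=> i j ij; have : u < (x i - x j) / 2.
      by move: i j ij; near: u.
    lra.
  by have [u Hu] := @filter_ex _ _ _ _ H; exists u.
have sgn (i : 'I_d) : (heatXn 1 n d).[x i - dl] * (heatXn 1 n d).[x i + dl] < 0.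
  have h1 : 0 < (-1) ^+ i * (heatXn 1 n d).[x i + dl].
    rewrite xE; apply: sign_prod_roots => [|j ji|j /andP[ij jd]].
    - exact/ltnW.
    - have jd : (j < d)%N by apply: ltn_trans ji _.
      by have := gap (Ordinal jd) i ji => /=; lra.
    - move: ij; rewrite leq_eqVlt => /orP[/eqP<-|ij]; first by lra.
      by have := gap i (Ordinal jd) ij => /=; lra.
  have h2 : 0 < (-1) ^+ i.+1 * (heatXn 1 n d).[x i - dl].
    rewrite xE; apply: sign_prod_roots => [//|j|j /andP[ij jd]].
      rewrite ltnS leq_eqVlt => /orP[/eqP->|ji]; first by lra.
      have jd : (j < d)%N by apply: ltn_trans ji _.
      by have := gap (Ordinal jd) i ji => /=; lra.
    by have := gap i (Ordinal jd) ij => /=; lra.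
  have e1 : (-1) ^+ i.+1 * (-1) ^+ i = -1 :> R.
    by rewrite exprS -mulrA -expr2 sqrr_sign mulr1.
  by have := mulr_gt0 h2 h1; rewrite mulrACA e1 mulN1r oppr_gt0.
pose F t y := (heat_flow (2 * t) n p).[2 * t * y] / (2 * t) ^+ d.
have near_sgn y : (heatXn 1 n d).[y] != 0 ->
    \forall t \near +oo, 0 < (heatXn 1 n d).[y] * F t y.
  by move=> y0; apply: eventually_same_sign => //; exact: heat_flow_horner_cvg.
(* finitely many points, so one threshold for [t] serves them all *)
have near_all : \forall t \near +oo, forall i : 'I_d,
    0 < (heatXn 1 n d).[x i - dl] * F t (x i - dl) /\
    0 < (heatXn 1 n d).[x i + dl] * F t (x i + dl).
  apply: filter_forall => i; have := sgn i.
  have [->|u0] := eqVneq (heatXn 1 n d).[x i - dl] 0.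
    by rewrite mul0r ltxx.
  have [->|v0] := eqVneq (heatXn 1 n d).[x i + dl] 0.
    by rewrite mulr0 ltxx.
  by move=> _; apply: filterI; apply: near_sgn.
near=> t.
have t0 : 0 < t by near: t; apply: nbhs_pinfty_gt; rewrite num_real.
have allt : forall i : 'I_d,
    0 < (heatXn 1 n d).[x i - dl] * F t (x i - dl) /\
    0 < (heatXn 1 n d).[x i + dl] * F t (x i + dl) by near: t.
have s0 : 0 < 2 * t by rewrite mulr_gt0.
have ex i : exists w, (i < d)%N -> [/\ 2 * t * (x i - dl) < w,
    w < 2 * t * (x i + dl) & root (heat_flow (2 * t) n p) w].
  have [id|_] := ltnP i d; last by exists 0.
  have [Fu Fv] := allt (Ordinal id); rewrite /= in Fu Fv.
  have := sgn (Ordinal id); rewrite /= => sg.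
  have FF : F t (x i - dl) * F t (x i + dl) < 0.
    have := mulr_gt0 Fu Fv; rewrite mulrACA => h.
    by rewrite -(nmulr_rgt0 _ sg).
  have [||w [? ? ?]] := @sign_change_root _ (heat_flow (2 * t) n p)
      (2 * t * (x i - dl)) (2 * t * (x i + dl)).
  - by rewrite ltr_pM2l //; lra.
  - move: FF; rewrite /F mulrACA pmulr_llt0 //.
    by rewrite mulr_gt0 // invr_gt0 exprn_gt0.
  - by exists w.
have [w Hw] := choice ex.
have dw : decreasing_upto d w.
  move=> i j /andP[ij jd]; have id := ltn_trans ij jd.
  have [_ wj _] := Hw _ jd; have [wi _ _] := Hw _ id.
  apply: (lt_trans wj); apply: (le_lt_trans _ wi).
  by rewrite ler_pM2l // ltW // (gap (Ordinal id) (Ordinal jd)).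
have [zt dz] := zE _ t0.
have hm : heat_flow (2 * t) n p \is monic by rewrite zt monic_prod_XsubC.
have hs : size (heat_flow (2 * t) n p) = d.+1.
  rewrite zt -(big_image _ _ _ _ (fun z => 'X - z%:P)) size_prod_XsubC.
  by rewrite size_map size_enum_ord.
have hw : heat_flow (2 * t) n p = prod_roots d w.
  by apply: monic_roots_eq_prod => // i /Hw[].
have -> : z t k = w k by apply: decreasing_roots_unique => //; rewrite -hw zt.
have [w1 w2 _] := Hw _ (ltn_ord k).
have q1 : 2 * (x k - dl) < w k / t by rewrite ltr_pdivlMr // mulrAC.
have q2 : w k / t < 2 * (x k + dl) by rewrite ltr_pdivrMr // mulrAC.
by rewrite ltr_norml; apply/andP; split; lra.
Unshelve. all: by end_near.
Qed.

End Main.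

Theorem theorem4p1 (R : realType) (n d : nat) (p : {poly R})
  (hd : (1 <= d)%N) (hdn : (d <= n)%N)
  (hmonic : p \is monic) (hdeg : size p = d.+1)
  (hp : nonneg_real_rooted d p) :
  (forall t : R, 0 < t ->
     nonneg_real_rooted d (rect_conv n d p (laguerre_heat n d t))) /\
  exists xi : 'I_d -> R,
    [/\ roots_of (laguerre d (n%:R : R)) xi,
        (forall i j : 'I_d, (i < j)%N -> xi j < xi i),
        (forall k, 0 < xi k) &
        forall r : R -> 'I_d -> R,
          (forall t : R, 0 < t ->
             roots_of (rect_conv n d p (laguerre_heat n d t))
                      (fun k => r t k ^+ 2) /\
             (forall i j : 'I_d, (i <= j)%N -> r t j ^+ 2 <= r t i ^+ 2)) ->
          forall k : 'I_d, (r t k ^+ 2 / t) @[t --> +oo] --> 2 * xi k].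
Proof.
have convE t : 0 < t ->
    rect_conv n d p (laguerre_heat n d t) = heat_flow (2 * t) n p.
  by move=> t0; rewrite laguerre_heat_heatXn ?gt_eqF // rect_conv_heat_flow.
have roots t : 0 < t -> exists z, [/\ heat_flow (2 * t) n p = prod_roots d z,
    decreasing_upto d z & forall i, (i < d)%N -> 0 < z i].
  by move=> t0; apply: heat_flow_roots => //; rewrite mulr_gt0.
split=> [t t0|].
  have [z [hE _ z0]] := roots t t0; rewrite convE // hE.
  exists (fun k : 'I_d => z k); split; last by move=> k; rewrite ltW ?z0.
  by rewrite /roots_of (monicP (monic_prod_roots d z)) scale1r.
have [x [xE dx x0]] : exists x : nat -> R, [/\ heatXn 1 n d = prod_roots d x,
    decreasing_upto d x & forall i, (i < d)%N -> 0 < x i].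
  have [||||x [xE dx x0]] := @heat_flow_roots R n d 'X^d 1 _ _ _ _.
  - exact: monicXn.
  - exact: size_polyXn.
  - exists (fun=> 0); split=> //.
    by rewrite /roots_of lead_coefXn scale1r subr0 prodr_const card_ord.
  - exact: ltr01.
  exists x; split=> //.
  rewrite -xE (heat_flowE _ _ (k := d.+1)) ?size_polyXn // big_ord_recr /=.
  rewrite coefXn eqxx scale1r big1 ?add0r // => i _.
  by rewrite coefXn ltn_eqF ?scale0r.
exists (fun k : 'I_d => x k); split => [|i j ij|k|r hr].
- rewrite /roots_of laguerre_heatXn xE lead_coefZ.
  by rewrite (monicP (monic_prod_roots d x)) mulr1.
- by apply: dx; rewrite ij /=.
- exact: x0.
- apply: (@scaled_roots_cvg R n d p x (fun t k => r t k ^+ 2)) => // t t0.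
  have [rE rd] := hr t t0; split => //.
  move: rE; rewrite convE // /roots_of; have [z [-> _ _]] := roots t t0.
  by rewrite (monicP (monic_prod_roots d z)) scale1r.
Qed.
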